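(* Let $\Sigma$ and $\Omega$ be finite sets. For all regular expressions $e,f$ over the alphabet $\Sigma+T_{\mathrm{BA}}$, if $\mathcal{H}_{\mathrm{kao}}^\star(\llbracket e\rrbracket)=\mathcal{H}_{\mathrm{kao}}^\star(\llbracket f\rrbracket)$ then $\mathsf{KA}_{\mathcal{H}_{\mathrm{kao}}}\vdash e=f$.
   Context: Regular expressions over an alphabet $X$: $e,f::=e+f\mid e\cdot f\mid e^*\mid 0\mid 1\mid a$ ($a\in X$), with usual language $\llbracket e\rrbracket$. Kleene algebra axioms: idempotent semiring axioms plus $1+xx^*\le x^*$, $x+yz\le z\Rightarrow y^*x\le z$, $x+yz\le y\Rightarrow xz^*\le y$ ($x\le y$ means $x+y=y$). A hypothesis is a pair $e\le f$; an equation as hypothesis stands for two inequations. $\mathsf{KA}_H\vdash e=f$ means derivable in equational logic from all instances of the Kleene algebra axioms and the hypotheses in $H$, letters being constants (no substitution rule). The $H$-closure $H^\star(L)$ is the smallest language containing $L$ such that for all $e\le f\in H$ and words $u,v$, $u\llbracket f\rrbracket v\subseteq H^\star(L)$ implies $u\llbracket e\rrbracket v\subseteq H^\star(L)$. $T_{\mathrm{BA}}$ is the set of Boolean expressions over $\Omega$ (connectives $\vee,\wedge,\neg,\bot,\top$), each a single letter of $\Sigma+T_{\mathrm{BA}}$. $\mathcal{H}_{\mathrm{bool}}$ is the set of all instances of Boolean algebra axioms (equations between elements of $T_{\mathrm{BA}}$). $\mathcal{H}_{\mathrm{kao}}=\mathcal{H}_{\mathrm{bool}}\cup\{\phi\wedge\psi\le\phi\cdot\psi,\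 \phi\vee\psi=\phi+\psi\mid\phi,\psi\in T_{\mathrm{BA}}\}\cup\{\bot=0\}$. *)

(* Defs.v *)
From mathcomp Require Import all_boot.

Set Implicit Arguments.
Unset Strict Implicit.
Unset Printing Implicit Defensive.

Inductive regexp (X : Type) : Type :=
  | Plus of regexp X & regexp X
  | Dot of regexp X & regexp X
  | Star of regexp X
  | Zero
  | One
  | Letter of X.

Arguments Zero {X}.
Arguments One {X}.

Declare Scope regexp_scope.
Delimit Scope regexp_scope with re.
Bind Scope regexp_scope with regexp.
Notation "e + f" := (Plus e f) : regexp_scope.
Notation "e * f" := (Dot e f) : regexp_scope.
Notation "0" := Zero : regexp_scope.
Notation "1" := One : regexp_scope.

Definition language (X : Type) := seq X -> Prop.

Inductive star_lang (X : Type) (L : language X) : language X :=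
  | star_nil : star_lang L [::]
  | star_cat u v : L u -> star_lang L v -> star_lang L (u ++ v).

Fixpoint lang (X : Type) (e : regexp X) : language X :=
  match e with
  | Plus e1 e2 => fun w => lang e1 w \/ lang e2 w
  | Dot e1 e2 =>
      fun w => exists u v, [/\ w = u ++ v, lang e1 u & lang e2 v]
  | Star e1 => star_lang (lang e1)
  | Zero => fun _ => False
  | One => fun w => w = [::]
  | Letter a => fun w => w = [:: a]
  end.

(* [H e f] reads "the inequation e <= f is one of the hypotheses". *)
Definition hypotheses (X : Type) := regexp X -> regexp X -> Prop.

(* An inequation x <= y is written out as x + y = y.  There is no substitution
   rule: the letters of X are constants. *)
Inductive KA_derives (X : Type) (H : hypotheses X) :
    regexp X -> regexp X -> Prop :=
  | KA_refl e : KA_derives H e e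
  | KA_sym e f : KA_derives H e f -> KA_derives H f e
  | KA_trans e f g : KA_derives H e f -> KA_derives H f g -> KA_derives H e g
  | KA_plus_cong e e' f f' :
      KA_derives H e e' -> KA_derives H f f' ->
      KA_derives H (e + f) (e' + f')
  | KA_dot_cong e e' f f' :
      KA_derives H e e' -> KA_derives H f f' ->
      KA_derives H (e * f) (e' * f')
  | KA_star_cong e e' :
      KA_derives H e e' -> KA_derives H (Star e) (Star e')
  | KA_plusA e f g : KA_derives H (e + (f + g)) ((e + f) + g)
  | KA_plusC e f : KA_derives H (e + f) (f + e)
  | KA_plus_idem e : KA_derives H (e + e) e
  | KA_plus0 e : KA_derives H (e + 0) e
  | KA_dotA e f g : KA_derives H (e * (f * g)) ((e * f) * g)
  | KA_dot1l e : KA_derives H (1 * e) e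
  | KA_dot1r e : KA_derives H (e * 1) e
  | KA_dot0l e : KA_derives H (0 * e) 0
  | KA_dot0r e : KA_derives H (e * 0) 0
  | KA_dotDl e f g : KA_derives H ((e + f) * g) (e * g + f * g)
  | KA_dotDr e f g : KA_derives H (e * (f + g)) (e * f + e * g)
  | KA_star_unfold x :
      KA_derives H ((1 + x * Star x) + Star x) (Star x)
  | KA_star_indl x y z :
      KA_derives H ((x + y * z) + z) z ->
      KA_derives H (Star y * x + z) z
  | KA_star_indr x y z :
      KA_derives H ((x + y * z) + y) y ->
      KA_derives H (x * Star z + y) y
  | KA_hyp e f : H e f -> KA_derives H (e + f) f.

Inductive Hclosure (X : Type) (H : hypotheses X) (L : language X) :
    language X :=
  | closure_base w : L w -> Hclosure H L w
  | closure_hyp e f u v w :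
      H e f ->
      (forall x, lang f x -> Hclosure H L (u ++ x ++ v)) ->
      lang e w -> Hclosure H L (u ++ w ++ v).

Inductive bexp (Omega : Type) : Type :=
  | BOr of bexp Omega & bexp Omega
  | BAnd of bexp Omega & bexp Omega
  | BNot of bexp Omega
  | BBot
  | BTop
  | BVar of Omega.

Arguments BBot {Omega}.
Arguments BTop {Omega}.

Inductive BA_axiom (Omega : Type) : bexp Omega -> bexp Omega -> Prop :=
  | BA_orA p q r : BA_axiom (BOr p (BOr q r)) (BOr (BOr p q) r)
  | BA_andA p q r : BA_axiom (BAnd p (BAnd q r)) (BAnd (BAnd p q) r)
  | BA_orC p q : BA_axiom (BOr p q) (BOr q p)
  | BA_andC p q : BA_axiom (BAnd p q) (BAnd q p)
  | BA_or_absorb p q : BA_axiom (BOr p (BAnd p q)) p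
  | BA_and_absorb p q : BA_axiom (BAnd p (BOr p q)) p
  | BA_or_distr p q r :
      BA_axiom (BOr p (BAnd q r)) (BAnd (BOr p q) (BOr p r))
  | BA_and_distr p q r :
      BA_axiom (BAnd p (BOr q r)) (BOr (BAnd p q) (BAnd p r))
  | BA_or_bot p : BA_axiom (BOr p BBot) p
  | BA_and_top p : BA_axiom (BAnd p BTop) p
  | BA_or_not p : BA_axiom (BOr p (BNot p)) BTop
  | BA_and_not p : BA_axiom (BAnd p (BNot p)) BBot.

(* Derivability from the axioms of Boolean algebra.  A Boolean expression is a
   single letter of a regular expression, so the rules of [KA_derives] never
   rewrite inside it; replacing equals by equals below a Boolean connective has
   to be provided here. *)
Inductive BA_derives (Omega : Type) : bexp Omega -> bexp Omega -> Prop :=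
  | BA_ax p q : BA_axiom p q -> BA_derives p q
  | BA_refl p : BA_derives p p
  | BA_sym p q : BA_derives p q -> BA_derives q p
  | BA_trans p q r : BA_derives p q -> BA_derives q r -> BA_derives p r
  | BA_or_cong p p' q q' :
      BA_derives p p' -> BA_derives q q' -> BA_derives (BOr p q) (BOr p' q')
  | BA_and_cong p p' q q' :
      BA_derives p p' -> BA_derives q q' -> BA_derives (BAnd p q) (BAnd p' q')
  | BA_not_cong p p' : BA_derives p p' -> BA_derives (BNot p) (BNot p').

Definition kao_regexp (Sigma Omega : Type) := regexp (Sigma + bexp Omega).

Definition test (Sigma Omega : Type) (p : bexp Omega) :
  kao_regexp Sigma Omega := Letter (inr p).

(* [BA_derives] is symmetric, so each equation yields both inequations. *)
Inductive H_bool (Sigma Omega : Type) : hypotheses (Sigma + bexp Omega) :=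
  | bool_le p q : BA_derives p q -> H_bool (test Sigma p) (test Sigma q).

Inductive H_kao (Sigma Omega : Type) : hypotheses (Sigma + bexp Omega) :=
  | kao_bool e f : H_bool e f -> H_kao e f
  | kao_and p q :
      H_kao (test Sigma (BAnd p q)) (test Sigma p * test Sigma q)%re
  | kao_or_le p q :
      H_kao (test Sigma (BOr p q)) (test Sigma p + test Sigma q)%re
  | kao_or_ge p q :
      H_kao (test Sigma p + test Sigma q)%re (test Sigma (BOr p q))
  | kao_bot_le : H_kao (test Sigma BBot) Zero
  | kao_bot_ge : H_kao Zero (test Sigma BBot).

(* Main.v *)
(* It suffices to derive [e <= f] when the language of [e] is contained in the
   closure of that of [f].  Every test is provably the sum of the atoms (the
   complete conjunctions of literals) below it, so words may be read over the
   finite alphabet of actions and atoms; there the only hypothesis left is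
   contraction, [a <= a * a] for atoms [a].

   Take an automaton for [f] whose states carry regular expressions bounding
   what they accept.  Replacing the transition relation of each atom by its
   transitive closure preserves these bounds, because atoms contract, and makes
   the set of words all of whose atomic refinements are accepted closed under
   the hypotheses.  Let [M] be the finite monoid of relations on states, and for
   [m] in [M] let [s m] be the least solution of the right Cayley graph of [M],
   an expression for the words whose relation is [m].  Leastness gives
   [s m * s n <= s (m n)], hence by induction [e] is below the sum of the [s m]
   for [m] the relation of a refinement of a word of [e].  Each such [m] is
   accepting, and leastness bounds [s m] by the label of the initial state, so
   by [f]. *)
Require Import Defs.
From Stdlib Require List.
From mathcomp Require Import all_boot.
From mathcomp Require Import boolp.

Set Implicit Arguments.
Unset Strict Implicit.
Unset Printing Implicit Defensive.

(** * Inequational reasoning and linear systems in Kleene algebra *)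

Definition KA_le (X : Type) (H : hypotheses X) (e f : regexp X) :=
  KA_derives H (e + f) f.

Section Inequations.
Variables (X : Type) (H : hypotheses X).
Implicit Types e f g x y z : regexp X.
Local Notation "e <~ f" := (KA_le H e%re f%re) (at level 70).

Lemma KA_eq_le e f : KA_derives H e f -> e <~ f.
Proof.
by move=> ef; apply: KA_trans (KA_plus_idem _ _); apply: KA_plus_cong ef (KA_refl _ _).
Qed.

Lemma KA_le_refl e : e <~ e.
Proof. exact: KA_plus_idem. Qed.

Lemma KA_le_trans f e g : e <~ f -> f <~ g -> e <~ g.
Proof.
move=> ef fg.
apply: KA_trans (KA_plus_cong (KA_refl _ e) (KA_sym fg)) _.
apply: KA_trans (KA_plusA _ _ _ _) _.
exact: KA_trans (KA_plus_cong ef (KA_refl _ g)) fg.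
Qed.

Lemma KA_le_anti e f : e <~ f -> f <~ e -> KA_derives H e f.
Proof.
by move=> ef fe; apply: KA_trans (KA_sym fe) (KA_trans (KA_plusC _ _ _) ef).
Qed.

Lemma KA_le_plusl e f : e <~ e + f.
Proof.
apply: KA_trans (KA_plusA _ _ _ _) _.
exact: KA_plus_cong (KA_plus_idem _ _) (KA_refl _ _).
Qed.

Lemma KA_le_plusr e f : f <~ e + f.
Proof. exact: KA_le_trans (KA_le_plusl f e) (KA_eq_le (KA_plusC _ _ _)). Qed.

Lemma KA_plus_le e f g : e <~ g -> f <~ g -> e + f <~ g.
Proof.
move=> eg fg; apply: KA_trans (KA_sym (KA_plusA _ _ _ _)) _.
exact: KA_trans (KA_plus_cong (KA_refl _ e) fg) eg.
Qed.

Lemma KA_zero_le e : 0 <~ e.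
Proof. exact: KA_trans (KA_plusC _ _ _) (KA_plus0 _ _). Qed.

Lemma KA_dot_le e e' f f' : e <~ e' -> f <~ f' -> e * f <~ e' * f'.
Proof.
move=> ee ff; apply: (@KA_le_trans (e' * f)).
  apply: KA_trans (KA_sym (KA_dotDl _ _ _ _)) _.
  exact: KA_dot_cong ee (KA_refl _ _).
apply: KA_trans (KA_sym (KA_dotDr _ _ _ _)) _.
exact: KA_dot_cong (KA_refl _ _) ff.
Qed.

Lemma KA_dotl_le e f f' : f <~ f' -> e * f <~ e * f'.
Proof. exact/KA_dot_le/KA_le_refl. Qed.

Lemma KA_dotr_le e e' f : e <~ e' -> e * f <~ e' * f.
Proof. by move=> ee; apply: KA_dot_le ee (KA_le_refl _). Qed.

Lemma KA_dotA_le w x y z v : y * z <~ w -> x * w <~ v -> (x * y) * z <~ v.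
Proof.
move=> yz; apply: KA_le_trans.
exact: KA_le_trans (KA_eq_le (KA_sym (KA_dotA _ _ _ _))) (KA_dotl_le x yz).
Qed.

Lemma KA_plus_dot_le x y z w : x * z <~ w -> y * z <~ w -> (x + y) * z <~ w.
Proof.
by move=> xz yz; apply: KA_le_trans (KA_eq_le (KA_dotDl _ _ _ _)) (KA_plus_le xz yz).
Qed.

Lemma KA_dot_plus_le x y z w : z * x <~ w -> z * y <~ w -> z * (x + y) <~ w.
Proof.
by move=> xz yz; apply: KA_le_trans (KA_eq_le (KA_dotDr _ _ _ _)) (KA_plus_le xz yz).
Qed.

Lemma KA_zero_dot_le e f : 0 * e <~ f.
Proof. exact: KA_le_trans (KA_eq_le (KA_dot0l _ _)) (KA_zero_le _). Qed.

Lemma KA_dot_zero_le e f : e * 0 <~ f.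
Proof. exact: KA_le_trans (KA_eq_le (KA_dot0r _ _)) (KA_zero_le _). Qed.

Lemma KA_one_dot_le e f g : e <~ 1 -> f <~ g -> e * f <~ g.
Proof.
by move=> e1 fg; apply: KA_le_trans (KA_dot_le e1 fg) (KA_eq_le (KA_dot1l _ _)).
Qed.

Lemma KA_dot_one_le e f g : e <~ g -> f <~ 1 -> e * f <~ g.
Proof.
by move=> eg f1; apply: KA_le_trans (KA_dot_le eg f1) (KA_eq_le (KA_dot1r _ _)).
Qed.

Lemma KA_le_one_dot e f g : 1 <~ e -> f <~ g -> f <~ e * g.
Proof.
move=> e1 fg; apply: KA_le_trans (KA_dot_le e1 fg).
exact/KA_eq_le/KA_sym/KA_dot1l.
Qed.

Lemma KA_le_dot_one e f g : f <~ e -> 1 <~ g -> f <~ e * g.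
Proof.
move=> fe g1; apply: KA_le_trans (KA_dot_le fe g1).
exact/KA_eq_le/KA_sym/KA_dot1r.
Qed.

Lemma KA_one_le_star e : 1 <~ Star e.
Proof. exact: KA_le_trans (KA_le_plusl _ _) (KA_star_unfold _ _). Qed.

Lemma KA_dot_star_le e : e * Star e <~ Star e.
Proof. exact: KA_le_trans (KA_le_plusr _ _) (KA_star_unfold _ _). Qed.

Lemma KA_star_dot_le x y z : x <~ z -> y * z <~ z -> Star y * x <~ z.
Proof. by move=> xz yz; apply/KA_star_indl/KA_plus_le. Qed.

Lemma KA_sum_le (I : Type) (r : seq I) (P : pred I) (F : I -> regexp X) z :
  (forall i, P i -> F i <~ z) -> \big[@Plus X/Zero]_(i <- r | P i) F i <~ z.
Proof.
move=> FP; apply: (big_ind (fun x => x <~ z)) => //; first exact: KA_zero_le.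
by move=> x y; apply: KA_plus_le.
Qed.

Lemma KA_dot_sum_le (I : Type) (r : seq I) (P : pred I) (F : I -> regexp X) x z :
  (forall i, P i -> x * F i <~ z) ->
  x * \big[@Plus X/Zero]_(i <- r | P i) F i <~ z.
Proof.
move=> FP; apply: (big_ind (fun y => x * y <~ z)) => //.
  exact: KA_dot_zero_le.
by move=> y y'; apply: KA_dot_plus_le.
Qed.

Lemma KA_sum_dot_le (I : Type) (r : seq I) (P : pred I) (F : I -> regexp X) x z :
  (forall i, P i -> F i * x <~ z) ->
  \big[@Plus X/Zero]_(i <- r | P i) F i * x <~ z.
Proof.
move=> FP; apply: (big_ind (fun y => y * x <~ z)) => //.
  exact: KA_zero_dot_le.
by move=> y y'; apply: KA_plus_dot_le.
Qed.

Lemma KA_le_sum (I : eqType) (r : seq I) (P : pred I) (F : I -> regexp X) i z :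
  i \in r -> P i -> z <~ F i -> z <~ \big[@Plus X/Zero]_(i <- r | P i) F i.
Proof.
move=> ir Pi zF; apply: (KA_le_trans zF); elim: r ir => //= j r IHr.
rewrite inE big_cons; have [<- _ | _ /= /IHr le_r] := eqVneq i j.
  by rewrite Pi; apply: KA_le_plusl.
by case: (P j) => //; apply: KA_le_trans le_r (KA_le_plusr _ _).
Qed.

(* Gaussian elimination: the head [i] of the list is removed by substituting
   [c i i ^* (b i + \sum_l c i l * t l)] for [t i] in the other equations. *)
Lemma linear_system (I : eqType) (s : seq I) (c : I -> I -> regexp X)
    (b : I -> regexp X) :
  uniq s ->
  {t : I -> regexp X |
    [/\ {in s, forall k, b k <~ t k},
        {in s &, forall k l, c k l * t l <~ t k}
      & forall (y : regexp X) (z : I -> regexp X),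
          {in s, forall k, b k * y <~ z k} ->
          {in s &, forall k l, c k l * z l <~ z k} ->
          {in s, forall k, t k * y <~ z k}]}.
Proof.
elim: s c b => [|i s IHs] c b /=; first by exists b.
case/andP=> i_notin uniq_s.
pose c' k l := (c k l + c k i * (Star (c i i) * c i l))%re.
pose b' k := (b k + c k i * (Star (c i i) * b i))%re.
have [t [bt ct t_least]] := IHs c' b' uniq_s.
(* The filter [l \in s] changes nothing in the sum, but hands the membership of each index to the
   lemmas on sums. *)
pose ti := (Star (c i i) * (b i + \big[@Plus X/Zero]_(l <- s | l \in s) (c i l * t l)))%re.
pose u k := if k == i then ti else t k.
have uE : {in s, u =1 t}.
  by move=> k ks; rewrite /u; case: eqP => // ki; rewrite -ki ks in i_notin.
have ui : u i = ti by rewrite /u eqxx.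
have cs_ti x : x <~ b i + \big[@Plus X/Zero]_(l <- s | l \in s) (c i l * t l) ->
    Star (c i i) * x <~ ti by exact: KA_dotl_le.
have le_ti x : x <~ b i + \big[@Plus X/Zero]_(l <- s | l \in s) (c i l * t l) ->
    x <~ ti.
  by move=> xle; apply: KA_le_one_dot xle; apply: KA_one_le_star.
exists u; split.
- move=> k; rewrite inE => /orP[/eqP->|ks].
    by rewrite ui; apply: le_ti; apply: KA_le_plusl.
  by rewrite uE //; apply: KA_le_trans (bt k ks); apply: KA_le_plusl.
- move=> k l; rewrite !inE => /orP[/eqP->|ks] /orP[/eqP->|ls]; rewrite ?ui ?uE //.
  + apply: KA_le_trans (KA_eq_le (KA_dotA _ _ _ _)) _.
    exact/KA_dotr_le/KA_dot_star_le.
  + apply: le_ti; apply: KA_le_trans (KA_le_plusr _ _).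
    exact: (KA_le_sum ls ls (KA_le_refl _)).
  (* Expanding [ti] gives exactly the second summands of [b' k] and of the [c' k m], which the
     reduced system already bounds by [t k]. *)
  + apply: KA_le_trans (KA_eq_le (KA_dotA _ _ _ _)) _.
    apply: KA_dot_plus_le.
      apply: KA_dotA_le (KA_le_refl _) _.
      by apply: KA_le_trans (bt k ks); apply: KA_le_plusr.
    apply: KA_dot_sum_le => m ms.
    apply: KA_le_trans (KA_eq_le (KA_dotA _ _ _ _)) _.
    apply: KA_le_trans (ct k m ks ms); apply: KA_dotr_le.
    apply: KA_dotA_le (KA_le_refl _) _.
    exact: KA_le_plusr.
  + by apply: KA_le_trans (ct k l ks ls); apply/KA_dotr_le/KA_le_plusl.
(* The factor [y] in leastness, inherited from [KA_star_indl], later serves to bound products of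
   solutions. *)
move=> y z bz cz.
have is_i : i \in i :: s by rewrite mem_head.
have in_s k : k \in s -> k \in i :: s by rewrite inE orbC => ->.
have star_z x : x <~ z i -> Star (c i i) * x <~ z i.
  by move=> xz; apply: KA_star_dot_le xz (cz _ _ is_i is_i).
have tz : {in s, forall k, t k * y <~ z k}.
  apply: t_least => [k ks | k l ks ls].
    apply: KA_plus_dot_le; first exact/bz/in_s.
    apply: KA_dotA_le (cz _ _ (in_s _ ks) is_i).
    exact: KA_dotA_le (bz _ is_i) (star_z _ (KA_le_refl _)).
  apply: KA_plus_dot_le; first by apply: cz; apply: in_s.
  apply: KA_dotA_le (cz _ _ (in_s _ ks) is_i).
  exact: KA_dotA_le (cz _ _ is_i (in_s _ ls)) (star_z _ (KA_le_refl _)).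
move=> k; rewrite inE => /orP[/eqP->|ks]; last by rewrite uE //; apply: tz.
rewrite ui; apply: KA_dotA_le (star_z _ (KA_le_refl _)).
apply: KA_plus_dot_le; first exact: bz.
apply: KA_sum_dot_le => l ls.
exact: KA_dotA_le (tz l ls) (cz _ _ is_i (in_s _ ls)).
Qed.

End Inequations.

(** * Preimages of the elements of a finite monoid under a morphism from words *)

Definition refinements (A X : Type) (R : A -> X -> Prop) (L : language X) :
    language A :=
  fun v => exists2 w, L w & List.Forall2 R v w.

Section FiniteMonoid.
Variables (X : Type) (H : hypotheses X) (A : finType) (c : A -> regexp X).
Variables (M : finType) (mul : M -> M -> M) (one : M).
Hypotheses (mulA : associative mul) (mul1 : left_id one mul)
  (mulr1 : right_id one mul).
Variable h : A -> M.
Local Notation "e <~ f" := (KA_le H e%re f%re) (at level 70).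

Definition word_image (v : seq A) : M := foldr (fun a => mul (h a)) one v.

Lemma word_image_cat u v :
  word_image (u ++ v) = mul (word_image u) (word_image v).
Proof. by elim: u => [|a u IHu] /=; rewrite ?mul1 // IHu mulA. Qed.

(* [t m k] denotes the words leading from [k] to [m] in the right Cayley graph
   of [M]. *)
Lemma Cayley_system :
  {t : M -> M -> regexp X |
    [/\ forall m, 1 <~ t m m,
        forall m k a, c a * t m (mul k (h a)) <~ t m k
      & forall m y z, y <~ z m ->
          (forall k a, c a * z (mul k (h a)) <~ z k) ->
          forall k, t m k * y <~ z k]}.
Proof.
pose C (k l : M) := \big[@Plus X/Zero]_(a | mul k (h a) == l) c a.
pose B (m k : M) : regexp X := if k == m then One else Zero.
pose t m := linear_system H C (B m) (enum_uniq M).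
exists (fun m => sval (t m)); split=> [m | m k a | m y z yz cz k];
  case: (t m) => /= {}t [Bt Ct t_least].
- by have := Bt m (mem_enum M m); rewrite /B eqxx.
- apply: KA_le_trans (Ct k (mul k (h a)) (mem_enum M _) (mem_enum M _)).
  apply: KA_dotr_le; apply: (@KA_le_sum _ _ _ _ _ _ a) => //.
  exact: KA_le_refl.
apply: t_least (mem_enum M k) => [l _ | l l' _ _].
  rewrite /B; case: eqP => [->|_]; last exact: KA_zero_dot_le.
  exact: KA_one_dot_le (KA_le_refl _ _) yz.
by apply: KA_sum_dot_le => a /eqP <-.
Qed.

Definition preimage_regexp (m : M) : regexp X := sval Cayley_system m one.
Local Notation s := preimage_regexp.

Lemma one_le_preimage : 1 <~ s one.
Proof. by rewrite /s; case: Cayley_system => t []. Qed.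

Lemma letter_le_preimage a : c a <~ s (h a).
Proof.
rewrite /s; case: Cayley_system => /= t [t1 ta _].
apply: KA_le_trans (ta (h a) one a); rewrite mul1.
exact: KA_le_dot_one (KA_le_refl _ _) (t1 _).
Qed.

Lemma preimage_least m z y :
  y <~ z m -> (forall k a, c a * z (mul k (h a)) <~ z k) -> s m * y <~ z one.
Proof.
move=> yz cz; rewrite /s; by case: Cayley_system => /= t [_ _ t_least]; apply: t_least.
Qed.

(** Leastness is used twice. Left multiplication by [m] is an endomorphism of the right Cayley
    graph, so [fun k => t (mul m n) (mul m k)] solves the system for [n]; at [one] this gives
    [t n one <~ t (mul m n) m]. That bound is the base case for leastness of [t m] with factor
    [t n one]. *)
Lemma preimage_mul m n : s m * s n <~ s (mul m n).
Proof.
rewrite [s m]/preimage_regexp [s n]/preimage_regexp [s (mul _ _)]/preimage_regexp.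
case: Cayley_system => /= t [t1 ta t_least].
apply: (t_least m (t n one) (t (mul m n))) => [|k a]; last exact: ta.
apply: KA_le_trans (KA_eq_le (KA_sym (KA_dot1r _ _))) _.
suff tn k : t n k * One <~ t (mul m n) (mul m k) by rewrite -{2}[m]mulr1.
apply: (t_least n One (fun k => t (mul m n) (mul m k))) => [|{}k a].
  exact: t1.
by rewrite mulA; apply: ta.
Qed.

(** The premise says that a letter is below every upper bound of its refinements, which settles the
    letter case of an induction on [e]; products and stars rest on [preimage_mul]. *)
Lemma le_sum_preimages (R : A -> X -> Prop) (e : regexp X) :
  (forall l z, (forall a, R a l -> c a <~ z) -> Letter l <~ z) ->
  e <~ \big[@Plus X/Zero]_(m : M |
         `[< exists2 v, refinements R (lang e) v & word_image v = m >]) s m.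
Proof.
move=> le_letter.
(* Taking arbitrary languages makes [S] monotone and submultiplicative, and these two facts cover
   all the operators. *)
pose S (L : language X) := \big[@Plus X/Zero]_(m : M |
  `[< exists2 v, refinements R L v & word_image v = m >]) s m.
have in_S (L : language X) v m x :
    refinements R L v -> word_image v = m -> x <~ s m -> x <~ S L.
  move=> Lv vm xm; apply: (@KA_le_sum _ _ _ _ _ _ m) => //.
  by apply/asboolP; exists v.
have S_dot (L1 L2 L : language X) :
    (forall w1 w2, L1 w1 -> L2 w2 -> L (w1 ++ w2)) -> S L1 * S L2 <~ S L.
  move=> L12; apply: KA_sum_dot_le => m /asboolP[v [w Lw vw] vm].
  apply: KA_dot_sum_le => n /asboolP[v' [w' Lw' vw'] vn].
  apply: (in_S L (v ++ v') _ _ _ _ (preimage_mul _ _)).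
    by exists (w ++ w'); [apply: L12 | apply: List.Forall2_app].
  by rewrite word_image_cat vm vn.
have S_sub (L L' : language X) : (forall w, L w -> L' w) -> S L <~ S L'.
  move=> LL; apply: KA_sum_le => m /asboolP[v [w Lw vw] vm].
  by apply: in_S vm (KA_le_refl _ _); exists w; first exact: LL.
have S_nil (L : language X) : L [::] -> 1 <~ S L.
  move=> L0; apply: (in_S L [::]) one_le_preimage => //.
  by exists [::] => //; constructor.
rewrite -/(S (lang e)); elim: e => [e1 IH1 e2 IH2|e1 IH1 e2 IH2|e IH|||l] /=.
- apply: KA_plus_le.
    by apply: KA_le_trans IH1 _; apply: S_sub => w; left.
  by apply: KA_le_trans IH2 _; apply: S_sub => w; right.
- apply: KA_le_trans (KA_dot_le IH1 IH2) _.
  by apply: S_dot => w1 w2; exists w1, w2.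
- apply: KA_le_trans (KA_eq_le (KA_sym (KA_dot1r _ _))) _.
  apply: KA_star_dot_le; first by apply: S_nil; constructor.
  apply: KA_le_trans (KA_dotr_le _ IH) _.
  by apply: S_dot => w1 w2; apply: star_cat.
- exact: KA_zero_le.
- exact: S_nil.
apply: le_letter => a al; apply: (in_S _ [:: a] (h a)).
- by exists [:: l] => //; constructor.
- by rewrite /= mulr1.
- exact: letter_le_preimage.
Qed.

End FiniteMonoid.

(** * Automata with labelled states and their runs *)

Record automaton (X A : Type) := Automaton {
  state : finType;
  initial : state;
  final : pred state;
  eps : rel state;
  step : A -> rel state;
  label : state -> regexp X
}.

Section Runs.
Variables (X A : Type).
Implicit Types N : automaton X A.

Inductive run N : state N -> seq A -> state N -> Prop :=
  | run_nil q : run q [::] q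
  | run_eps q r s v : eps q r -> run r v s -> run q v s
  | run_step a q r s v : step a q r -> run r v s -> run q (a :: v) s.

Definition accepts N (v : seq A) := exists2 q, final q & run (initial N) v q.

Lemma run_cat N (q r s : state N) u v :
  run q u r -> run r v s -> run q (u ++ v) s.
Proof.
elim=> {q u r} [//|q r t w qr _ IH /IH|a q r t w qr _ IH /IH].
  exact: run_eps.
exact: run_step.
Qed.

Lemma run_embed N N' (g : state N -> state N') :
  (forall q r, eps q r -> eps (g q) (g r)) ->
  (forall a q r, step a q r -> step a (g q) (g r)) ->
  forall q v r, run q v r -> run (g q) v (g r).
Proof.
move=> geps gstep q v r; elim=> [*|? ? ? ? /geps qr _|? ? ? ? ? /gstep qr _].
- exact: run_nil.
- exact: run_eps.
- exact: run_step.
Qed.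

End Runs.

(* The labels form a pre-fixed point of the transitions, so that the label of
   a state bounds the language accepted from it. *)
Record labelling (X A : Type) (H : hypotheses X) (c : A -> regexp X)
    (N : automaton X A) (f : regexp X) : Prop := Labelling {
  label_initial : KA_le H (label (initial N)) f;
  label_final : forall q : state N, final q -> KA_le H 1 (label q);
  label_eps : forall q r : state N, eps q r -> KA_le H (label r) (label q);
  label_step : forall a (q r : state N),
    step a q r -> KA_le H (c a * label r) (label q)
}.

(** * Thompson's construction, carried out together with the labels *)

Section Thompson.
Variables (X A : Type) (H : hypotheses X) (c : A -> regexp X).
Variable R : A -> X -> Prop.
Hypothesis c_letter : forall a l, R a l -> KA_le H (c a) (Letter l).
Local Notation "e <~ f" := (KA_le H e%re f%re) (at level 70).
Implicit Types N : automaton X A.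

Definition plus_automaton N1 N2 f : automaton X A :=
  @Automaton X A (option (state N1 + state N2)%type) None
    (fun q => match q with
      | Some (inl q) => final q | Some (inr q) => final q | None => false end)
    (fun q r => match q, r with
      | None, Some (inl r) => r == initial N1
      | None, Some (inr r) => r == initial N2
      | Some (inl q), Some (inl r) => eps q r
      | Some (inr q), Some (inr r) => eps q r
      | _, _ => false end)
    (fun a q r => match q, r with
      | Some (inl q), Some (inl r) => step a q r
      | Some (inr q), Some (inr r) => step a q r
      | _, _ => false end)
    (fun q => match q with
      | Some (inl q) => label q | Some (inr q) => label q | None => f end).

(** From a state of [N1] a word of [f2] remains to be read after [N1] has accepted, whence the
    factor [f2] in the label. *)
Definition dot_automaton N1 N2 f2 : automaton X A :=
  @Automaton X A (state N1 + state N2)%type (inl (initial N1))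
    (fun q => match q with inl _ => false | inr q => final q end)
    (fun q r => match q, r with
      | inl q, inl r => eps q r
      | inl q, inr r => final q && (r == initial N2)
      | inr q, inr r => eps q r
      | inr _, inl _ => false end)
    (fun a q r => match q, r with
      | inl q, inl r => step a q r
      | inr q, inr r => step a q r
      | _, _ => false end)
    (fun q => match q with inl q => label q * f2 | inr q => label q end)%re.

(** The fresh state [None] accepts the empty word and starts every iteration. Making [initial N]
    final instead would be unsound when a run of [N] can come back to it. *)
Definition star_automaton N f : automaton X A :=
  @Automaton X A (option (state N)) None
    (fun q => q == None)
    (fun q r => match q, r with
      | None, Some r => r == initial N
      | Some q, Some r => eps q r
      | Some q, None => final q
      | None, None => false end)
    (fun a q r => match q, r with
      | Some q, Some r => step a q r | _, _ => false end)
    (fun q => if q is Some q then label q * Star f else Star f)%re.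

Definition const_automaton (b : bool) (f : regexp X) : automaton X A :=
  @Automaton X A unit tt (fun _ => b) (fun _ _ => false)
    (fun _ _ _ => false) (fun _ => f).

Definition letter_automaton (l : X) : automaton X A :=
  @Automaton X A bool false id (fun _ _ => false)
    (fun a q r => [&& ~~ q, r & `[< R a l >]])
    (fun q => if q then One else Letter l).

(** Acceptance is proved in one direction only: that the automaton accepts no more than [f] allows
    is expressed algebraically, by the labelling. *)
Lemma Thompson (f : regexp X) :
  exists2 N, labelling H c N f
    & forall v, refinements R (lang f) v -> accepts N v.
Proof.
elim: f => [f1 [N1 L1 acc1] f2 [N2 L2 acc2]|f1 [N1 L1 acc1] f2 [N2 L2 acc2]
           |f [N L acc]|||l].
- exists (plus_automaton N1 N2 (f1 + f2)).
    split.
    + exact: KA_le_refl.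
    + by case=> [[q|q]|] //; [apply: (label_final L1)|apply: (label_final L2)].
    + case=> [[q|q]|] [[r|r]|] //=.
      * exact: (label_eps L1).
      * exact: (label_eps L2).
      * by move/eqP->; apply: KA_le_trans (label_initial L1) (KA_le_plusl _ _ _).
      * by move/eqP->; apply: KA_le_trans (label_initial L2) (KA_le_plusr _ _ _).
    + by move=> a [[q|q]|] [[r|r]|] //=; [apply: (label_step L1)|apply: (label_step L2)].
  move=> v [w [fw|fw] vw].
    have [|q Fq rq] := acc1 v; first by exists w.
    exists (Some (inl q)) => //;
      apply: (@run_eps _ _ (plus_automaton N1 N2 _) None
        (Some (inl (initial N1))))
        => /=.
      by rewrite eqxx.
    by apply: (@run_embed _ _ N1 (plus_automaton N1 N2 _) (Some \o inl)).
  have [|q Fq rq] := acc2 v; first by exists w.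
  exists (Some (inr q)) => //;
    apply: (@run_eps _ _ (plus_automaton N1 N2 _) None
      (Some (inr (initial N2))))
        => /=.
    by rewrite eqxx.
  by apply: (@run_embed _ _ N2 (plus_automaton N1 N2 _) (Some \o inr)).
- exists (dot_automaton N1 N2 f2).
    split.
    + exact: KA_dotr_le (label_initial L1).
    + by case=> [q|q] //; apply: (label_final L2).
    + case=> [q|q] [r|r] //=.
      * by move/(label_eps L1)/KA_dotr_le.
      * case/andP=> Fq /eqP->.
        exact: KA_le_one_dot (label_final L1 Fq) (label_initial L2).
      * exact: (label_eps L2).
    + move=> a [q|q] [r|r] //=; last exact: (label_step L2).
      move/(label_step L1) => aqr.
      exact: KA_le_trans (KA_eq_le (KA_dotA _ _ _ _)) (KA_dotr_le _ aqr).
  move=> v [_ [w1 [w2 [-> fw1 fw2]]] /List.Forall2_app_inv_r].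
  case=> v1 [v2 [vw1 [vw2 ->]]].
  have [|q1 Fq1 rq1] := acc1 v1; first by exists w1.
  have [|q2 Fq2 rq2] := acc2 v2; first by exists w2.
  exists (inr q2) => //; apply: (@run_cat _ _ (dot_automaton N1 N2 _) _ (inl q1)).
    exact: (@run_embed _ _ N1 (dot_automaton N1 N2 _) inl).
  apply: (@run_eps _ _ (dot_automaton N1 N2 _) (inl q1) (inr (initial N2))).
    by rewrite /= Fq1 eqxx.
  exact: (@run_embed _ _ N2 (dot_automaton N1 N2 _) inr).
- exists (star_automaton N f).
    split.
    + exact: KA_le_refl.
    + by case=> //= _; apply: KA_one_le_star.
    + case=> [q|] [r|] //=.
      * by move/(label_eps L)/KA_dotr_le.
      * by move=> Fq; apply: KA_le_one_dot (label_final L Fq) (KA_le_refl _ _).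
      * move/eqP->; apply: KA_le_trans (KA_dotr_le _ (label_initial L)) _.
        exact: KA_dot_star_le.
    + move=> a [q|] [r|] //= /(label_step L) aqr.
      exact: KA_le_trans (KA_eq_le (KA_dotA _ _ _ _)) (KA_dotr_le _ aqr).
  move=> v [w fw vw]; exists None => //=.
  elim: fw v vw => [|w1 w2 fw1 _ IH] v.
    by move=> vw; inversion vw; apply: run_nil.
  move=> /List.Forall2_app_inv_r[v1 [v2 [vw1 [vw2 ->]]]].
  have [|q Fq rq] := acc v1; first by exists w1.
  apply: (@run_eps _ _ (star_automaton N _) None (Some (initial N))); first exact: eqxx.
  apply: run_cat; last by apply: (@run_eps _ _ (star_automaton N _) (Some q) None); last exact: IH.
  exact: (@run_embed _ _ N (star_automaton N _) Some).
- by exists (const_automaton false Zero) => [|v []] //; split=> //; exact: KA_le_refl.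
- exists (const_automaton true One).
    by split=> // *; apply: KA_le_refl.
  move=> v [w -> vw]; inversion vw.
  by exists tt => //; apply: run_nil.
- exists (letter_automaton l).
    split=> //; first exact: KA_le_refl.
      by case=> // _; apply: KA_le_refl.
    move=> a [] [] //= /asboolP al.
    exact: KA_dot_one_le (c_letter al) (KA_le_refl _ _).
  move=> v [_ -> vw]; inversion vw as [|a l' v' w' al vw']; subst.
  inversion vw'; subst.
  exists true => //; apply: (@run_step _ _ (letter_automaton l) a false true); last exact: run_nil.
  exact/asboolP.
Qed.

End Thompson.

(** * The monoid of binary relations on a finite set *)

Section RelationMonoid.
Variable Q : finType.
Implicit Types r s t : {set Q * Q}.

Definition rel_comp r s : {set Q * Q} :=
  [set p | [exists q, ((p.1, q) \in r) && ((q, p.2) \in s)]].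

Definition rel_diag : {set Q * Q} := [set p | p.1 == p.2].

Lemma rel_compP r s x y :
  reflect (exists2 q, (x, q) \in r & (q, y) \in s) ((x, y) \in rel_comp r s).
Proof.
rewrite inE; apply: (iffP existsP) => [[q /andP[]]|[q xq qy]]; exists q => //.
exact/andP.
Qed.

Lemma rel_compA : associative rel_comp.
Proof.
move=> r s t; apply/setP=> -[x y]; apply/rel_compP/rel_compP.
  case=> q xq /rel_compP[q' qq' q'y]; exists q' => //.
  by apply/rel_compP; exists q.
case=> q /rel_compP[q' xq' q'q] qy; exists q' => //.
by apply/rel_compP; exists q.
Qed.

Lemma rel_comp1 : left_id rel_diag rel_comp.
Proof.
move=> r; apply/setP=> -[x y]; apply/rel_compP/idP.
  by case=> q; rewrite inE => /eqP /= ->.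
by exists x => //; rewrite inE /=.
Qed.

Lemma rel_compr1 : right_id rel_diag rel_comp.
Proof.
move=> r; apply/setP=> -[x y]; apply/rel_compP/idP.
  by case=> q xq; rewrite inE => /eqP /= <-.
by exists y => //; rewrite inE /=.
Qed.

Lemma rel_comp_subset r r' s s' :
  r \subset r' -> s \subset s' -> rel_comp r s \subset rel_comp r' s'.
Proof.
move=> /subsetP rr /subsetP ss; apply/subsetP=> -[x y] /rel_compP[q xq qy].
by apply/rel_compP; exists q; [apply: rr|apply: ss].
Qed.

End RelationMonoid.

(** * Saturating an automaton under contraction of letters *)

Section Saturation.
Variables (X : Type) (H : hypotheses X) (A : finType) (c : A -> regexp X).
Variables (contracting : pred A) (N : automaton X A).
Hypothesis c_contr : forall a, contracting a -> KA_le H (c a) (c a * c a).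
Local Notation "e <~ f" := (KA_le H e%re f%re) (at level 70).
Local Notation Q := (state N).

(* Besides absorbing the silent moves that follow a letter, this makes the
   relation of a contracting letter transitive. *)
Definition saturated_step (a : A) : {set Q * Q} :=
  [set p | [exists q, step a p.1 q &&
    connect [rel q r | eps q r || contracting a && step a q r] q p.2]].

Lemma saturated_stepP a x y :
  reflect (exists2 q, step a x q
             & connect [rel q r | eps q r || contracting a && step a q r] q y)
          ((x, y) \in saturated_step a).
Proof.
rewrite inE; apply: (iffP existsP) => [[q /andP[]]|[q xq qy]]; exists q => //.
exact/andP.
Qed.

Lemma saturated_step_trans a :
  contracting a ->
  rel_comp (saturated_step a) (saturated_step a) \subset saturated_step a.
Proof.
move=> ca; apply/subsetP=> -[x y] /rel_compP[q].
case/saturated_stepP=> q1 xq1 q1q /saturated_stepP[q2 qq2 q2y].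
apply/saturated_stepP; exists q1 => //.
apply: connect_trans q1q (connect_trans (connect1 _) q2y).
by rewrite /= ca qq2 orbT.
Qed.

Definition relation_of_word : seq A -> {set Q * Q} :=
  word_image (@rel_comp Q) (rel_diag Q) saturated_step.

Lemma relation_of_word_cat u v :
  relation_of_word (u ++ v) = rel_comp (relation_of_word u) (relation_of_word v).
Proof. exact: word_image_cat (@rel_compA Q) (@rel_comp1 Q) _ _ _. Qed.

(** A saturated step absorbs silent moves only after its letter, so those preceding the first letter
    are supplied here. *)
Definition accepting (m : {set Q * Q}) :=
  [exists p in m, connect (@eps _ _ N) (initial N) p.1 &&
    [exists r, connect (@eps _ _ N) p.2 r && final r]].

Lemma accepting_subset (m n : {set Q * Q}) : m \subset n -> accepting m -> accepting n.
Proof.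
move=> /subsetP mn /existsP[p /andP[/mn pn pP]].
by apply/existsP; exists p; rewrite pn.
Qed.

Lemma run_relation q v r : run q v r ->
  exists p, [/\ p \in relation_of_word v, connect (@eps _ _ N) q p.1
              & connect (@eps _ _ N) p.2 r].
Proof.
elim=> {q r v} [q | q r s v qr _ [p [pv rp ps]] | a q r s v aqr _ [p [pv rp ps]]].
- by exists (q, q); split=> //; rewrite inE /=.
- by exists p; split=> //; apply: connect_trans (connect1 qr) rp.
exists (q, p.2); split=> //=; apply/rel_compP; exists p.1; last by case: (p) pv.
apply/saturated_stepP; exists r => //; apply: connect_sub rp => x y xy.
by apply: connect1; rewrite /= xy.
Qed.

Lemma accepts_accepting v : accepts N v -> accepting (relation_of_word v).
Proof.
case=> r Fr /run_relation[p [pv ip pr]].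
apply/existsP; exists p; rewrite pv ip /=.
by apply/existsP; exists r; rewrite pr Fr.
Qed.

(** Composition of relations is monotone and acceptance is upward closed, so transitivity of the
    relation of [a] suffices. *)
Lemma accepting_contraction a u v : contracting a ->
  accepting (relation_of_word (u ++ [:: a, a & v])) ->
  accepting (relation_of_word (u ++ a :: v)).
Proof.
move=> ca; apply: accepting_subset; rewrite !relation_of_word_cat.
apply: rel_comp_subset => //.
rewrite -[_ :: v]/([:: a] ++ v) -[[:: a, a & v]]/([:: a; a] ++ v).
rewrite !relation_of_word_cat rel_comp_subset //.
rewrite /relation_of_word /= !rel_compr1.
exact: saturated_step_trans.
Qed.

(** Bounds on labels travel backwards along a path. [P] is left abstract because the bound is
    sometimes on the label alone and sometimes on its product with a letter. *)
Lemma label_connect (P : regexp X -> Prop) (e : rel Q) q r :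
  (forall x y, e x y -> P (label y) -> P (label x)) ->
  connect e q r -> P (label r) -> P (label q).
Proof.
move=> Pe /connectP[p]; elim: p q => [|x p IHp] q /=; first by move=> _ ->.
by move=> /andP[qx px] r_last Pr; apply: Pe qx (IHp x px r_last Pr).
Qed.

(** The sums [z k] of the labels of the states reached through [k] solve the Cayley system.
    Acceptance of [m] puts [1] below [z m], so leastness bounds the preimage of [m] by [z] at the
    identity, where only states silently reachable from the initial one count. *)
Lemma preimage_regexp_le f m : labelling H c N f -> accepting m ->
  preimage_regexp H c (@rel_comp Q) (rel_diag Q) saturated_step m <~ f.
Proof.
move=> L /existsP[[p1 p2] /and3P[/= pm ip /existsP[r /andP[pr Fr]]]].
pose z (k : {set Q * Q}) := \big[@Plus X/Zero]_(q |
  [exists x, connect (@eps _ _ N) (initial N) x && ((x, q) \in k)]) label q.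
have le_z (k : {set Q * Q}) x q e : connect (@eps _ _ N) (initial N) x -> (x, q) \in k ->
    e <~ label q -> e <~ z k.
  move=> ix xq; apply: KA_le_sum => //.
  by apply/existsP; exists x; rewrite ix.
apply: (@KA_le_trans _ _ (z (rel_diag Q))); last first.
  apply: KA_sum_le => q /existsP[x /andP[ix]].
  rewrite inE => /eqP /= xq; subst x; apply: KA_le_trans (label_initial L).
  apply: (label_connect (P := fun e => label q <~ e)) ix (KA_le_refl _ _).
  by move=> x y /(label_eps L) yx qy; apply: KA_le_trans qy yx.
apply: KA_le_trans (KA_eq_le (KA_sym (KA_dot1r _ _))) _.
apply: (@preimage_least _ _ _ c _ _ _ _ m z) => [|k a].
  apply: le_z ip pm _.
  apply: (label_connect (P := fun e => 1 <~ e)) pr (label_final L Fr).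
  by move=> x y /(label_eps L) yx qy; apply: KA_le_trans qy yx.
apply: KA_dot_sum_le => q /existsP[x /andP[ix]].
case/rel_compP=> y xy /saturated_stepP[q' yq' q'q].
apply: (le_z _ _ _ _ ix xy); apply: KA_le_trans (label_step L yq').
apply: (label_connect (P := fun e => c a * label q <~ c a * e)) q'q (KA_le_refl _ _).
move=> x' y' /orP[/(label_eps L) yx | /andP[ca /(label_step L) ayx]] qy.
  exact: KA_le_trans qy (KA_dotl_le _ yx).
(* A further move by [a] inside the saturated step: duplicate [c a] by contraction and let the
   second copy be consumed by that move. *)
apply: (KA_le_trans qy).
apply: KA_le_trans (KA_dotr_le _ (c_contr ca)) _.
exact: KA_dotA_le ayx (KA_le_refl _ _).
Qed.

End Saturation.

(** * Boolean expressions, valuations and atoms *)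

Section BooleanAlgebra.
Variable Omega : finType.
Implicit Types (p q r : bexp Omega) (V W : {set Omega}).
Local Notation "p === q" := (BA_derives p q) (at level 70).

Fixpoint beval V p : bool :=
  match p with
  | BOr p q => beval V p || beval V q
  | BAnd p q => beval V p && beval V q
  | BNot p => ~~ beval V p
  | BBot => false
  | BTop => true
  | BVar x => x \in V
  end.

Lemma BA_derives_sound p q : p === q -> forall V, beval V p = beval V q.
Proof.
elim=> {p q} [p q [] * /=|//|p q _ IH V|p q r _ IH1 _ IH2 V|p p' q q' _ IH1 _ IH2 V
    |p p' q q' _ IH1 _ IH2 V|p p' _ IH V] /=.
- exact: orbA.
- exact: andbA.
- exact: orbC.
- exact: andbC.
- by case: beval.
- by case: beval.
- exact: orb_andr.
- exact: andb_orr.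
- exact: orbF.
- exact: andbT.
- exact: orbN.
- exact: andbN.
- by rewrite IH.
- by rewrite IH1.
- by rewrite IH1 IH2.
- by rewrite IH1 IH2.
- by rewrite IH.
Qed.

Lemma BA_andl p p' q : p === p' -> BAnd p q === BAnd p' q.
Proof. by move=> pp; apply: BA_and_cong pp (BA_refl _). Qed.

Lemma BA_andr p q q' : q === q' -> BAnd p q === BAnd p q'.
Proof. exact/BA_and_cong/BA_refl. Qed.

Lemma BA_and_idem p : BAnd p p === p.
Proof.
apply: BA_trans (BA_ax (BA_and_absorb p BBot)).
exact/BA_andr/BA_sym/BA_ax/BA_or_bot.
Qed.

Lemma BA_and_bot p : BAnd p BBot === BBot.
Proof.
apply: BA_trans (BA_andr _ (BA_sym (BA_ax (BA_and_not p)))) _.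
apply: BA_trans (BA_ax (BA_andA _ _ _)) _.
exact: BA_trans (BA_andl _ (BA_and_idem _)) (BA_ax (BA_and_not _)).
Qed.

Lemma BA_bot_and p : BAnd BBot p === BBot.
Proof. exact: BA_trans (BA_ax (BA_andC _ _)) (BA_and_bot _). Qed.

Lemma BA_bot_or p : BOr BBot p === p.
Proof. exact: BA_trans (BA_ax (BA_orC _ _)) (BA_ax (BA_or_bot _)). Qed.

Definition literal V x : bexp Omega :=
  if x \in V then BVar x else BNot (BVar x).

(** The list of variables is a parameter so that they can be split off one at a time; the genuine
    atoms are those for [enum Omega]. *)
Definition atom V (s : seq Omega) : bexp Omega :=
  foldr (fun x => BAnd (literal V x)) BTop s.

Lemma atom_and_literal V s x :
  x \in s -> BAnd (atom V s) (literal V x) === atom V s.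
Proof.
elim: s => //= y s IHs; rewrite inE; have [<- _|_ /IHs as_x] := eqVneq x y.
  apply: BA_trans (BA_ax (BA_andC _ _)) _.
  apply: BA_trans (BA_ax (BA_andA _ _ _)) _.
  exact/BA_andl/BA_and_idem.
apply: BA_trans (BA_sym (BA_ax (BA_andA _ _ _))) _.
exact: BA_andr.
Qed.

Lemma BA_le_not p q : BAnd p q === p -> BAnd p (BNot q) === BBot.
Proof.
move=> pq; apply: BA_trans (BA_andl _ (BA_sym pq)) _.
apply: BA_trans (BA_sym (BA_ax (BA_andA _ _ _))) _.
exact: BA_trans (BA_andr _ (BA_ax (BA_and_not _))) (BA_and_bot _).
Qed.

Lemma BA_split p q : p === BOr (BAnd p q) (BAnd p (BNot q)).
Proof.
apply: BA_trans (BA_ax (BA_and_distr _ _ _)).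
apply: BA_trans (BA_sym (BA_ax (BA_and_top _))) _.
exact/BA_andr/BA_sym/BA_ax/BA_or_not.
Qed.

Lemma BA_disjoint_le_not p q : BAnd p q === BBot -> BAnd p (BNot q) === p.
Proof.
move=> pq; apply: BA_sym; apply: BA_trans (BA_split p q) _.
exact: BA_trans (BA_or_cong pq (BA_refl _)) (BA_bot_or _).
Qed.

Lemma BA_not_le_disjoint p q : BAnd p (BNot q) === p -> BAnd p q === BBot.
Proof.
move=> pq; apply: BA_trans (BA_andl _ (BA_sym pq)) _.
apply: BA_trans (BA_sym (BA_ax (BA_andA _ _ _))) _.
apply: BA_trans (BA_andr _ (BA_ax (BA_andC _ _))) _.
exact: BA_trans (BA_andr _ (BA_ax (BA_and_not _))) (BA_and_bot _).
Qed.

(** An atom decides each variable through its literal, and being decided passes through the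
    connectives. Negation exchanges the two outcomes by the complement laws. *)
Lemma atom_and V p :
  BAnd (atom V (enum Omega)) p
    === if beval V p then atom V (enum Omega) else BBot.
Proof.
elim: p => [p IHp q IHq|p IHp q IHq|p IHp|||x] /=.
- apply: BA_trans (BA_ax (BA_and_distr _ _ _)) _.
  apply: BA_trans (BA_or_cong IHp IHq) _.
  case: (beval V p); case: (beval V q) => /=.
  + apply: BA_trans (BA_ax (BA_or_absorb _ _)).
    exact: BA_or_cong (BA_refl _) (BA_sym (BA_and_idem _)).
  + exact/BA_ax/BA_or_bot.
  + exact: BA_bot_or.
  + exact: BA_bot_or.
- apply: BA_trans (BA_ax (BA_andA _ _ _)) _.
  apply: BA_trans (BA_andl _ IHp) _.
  by case: (beval V p) => //=; apply: BA_bot_and.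
- case: (beval V p) IHp => /= IHp; first exact: BA_le_not.
  exact: BA_disjoint_le_not.
- exact: BA_and_bot.
- exact/BA_ax/BA_and_top.
have := atom_and_literal V (mem_enum Omega x); rewrite /literal.
by case: ifP => // _; apply: BA_not_le_disjoint.
Qed.

Lemma eq_atom V W (s : seq Omega) : {in s, forall x, (x \in V) = (x \in W)} ->
  atom V s = atom W s.
Proof.
elim: s => //= x s IHs VW; rewrite /literal VW ?mem_head //.
by rewrite IHs // => y ys; apply: VW; rewrite inE ys orbT.
Qed.

End BooleanAlgebra.

(** * Tests as joins of atoms, and soundness of acceptance for the hypotheses *)

Section Tests.
Variables Sigma Omega : finType.
Implicit Types (p q : bexp Omega) (V W : {set Omega}).
Local Notation X := (Sigma + bexp Omega)%type.
Local Notation H := (@H_kao Sigma Omega).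
Local Notation "e <~ f" := (KA_le H e%re f%re) (at level 70).
Local Notation test := (test Sigma).

Lemma test_BA_le p q : BA_derives p q -> test p <~ test q.
Proof. by move=> pq; apply/KA_hyp/kao_bool/bool_le. Qed.

Lemma test_or_le p q z : test p <~ z -> test q <~ z -> test (BOr p q) <~ z.
Proof.
by move=> pz qz; apply: KA_le_trans (KA_hyp (kao_or_le _ _ _)) (KA_plus_le pz qz).
Qed.

(** The Boolean order becomes the algebraic one through the disjunction: [kao_or_ge] puts [p] below
    [BOr q p], which absorption reduces to [q]. *)
Lemma test_le p q : BA_derives (BAnd p q) p -> test p <~ test q.
Proof.
move=> pq; apply: (@KA_le_trans _ _ (test (BOr q p))).
  by apply: KA_le_trans (KA_le_plusr _ _ _) (KA_hyp (kao_or_ge _ _ _)).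
apply: test_BA_le; apply: BA_trans (BA_ax (BA_or_absorb q p)).
apply: BA_or_cong (BA_refl _) (BA_trans (BA_sym pq) (BA_ax (BA_andC _ _))).
Qed.

Lemma test_le_dot p : test p <~ test p * test p.
Proof.
apply: KA_le_trans (KA_hyp (kao_and _ _ _)).
exact/test_BA_le/BA_sym/BA_and_idem.
Qed.

(** Excluded middle is applied to one variable of [s] after another, and [kao_or_le] turns each
    resulting disjunction into a sum. *)
Lemma test_le_atoms (s : seq Omega) p z : uniq s ->
  (forall V, test (BAnd (atom V s) p) <~ z) -> test p <~ z.
Proof.
elim: s p => [|x s IHs] p /=.
  (* Over the empty list every atom is [BTop], so any valuation would serve. *)
  move=> _ /(_ set0); apply: KA_le_trans; apply: test_BA_le.
  exact: BA_trans (BA_sym (BA_ax (BA_and_top _))) (BA_ax (BA_andC _ _)).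
case/andP=> x_notin uniq_s le_z; apply: IHs => // V.
have in_z W : {in s, forall y, (y \in V) = (y \in W)} ->
    test (BAnd (BAnd (atom V s) p) (literal W x)) <~ z.
  move=> VW; apply: KA_le_trans (le_z W); apply: test_BA_le.
  rewrite (eq_atom VW).
  apply: BA_trans (BA_ax (BA_andC _ _)) _.
  exact: BA_ax (BA_andA _ _ _).
apply: KA_le_trans (test_BA_le (BA_split _ (BVar x))) _.
apply: test_or_le.
  (* Each half of the split uses the valuation that sets [x] accordingly; since [x] is not in [s],
     this leaves [atom V s] unchanged. *)
  have := in_z (x |: V); rewrite /literal setU11; apply=> y ys.
  by rewrite !inE; case: eqP => // yx; rewrite -yx ys in x_notin.
have := in_z (V :\ x); rewrite /literal setD11; apply=> y ys.
by rewrite !inE; case: eqP => // yx; rewrite -yx ys in x_notin.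
Qed.

(** Representing atoms by valuations makes the refined alphabet a finite type, although the Boolean
    expressions are infinitely many. *)
Definition atomic_letter (a : Sigma + {set Omega}) : regexp X :=
  match a with
  | inl x => Letter (inl x)
  | inr V => test (atom V (enum Omega))
  end.

Definition atomic_below (a : Sigma + {set Omega}) (l : X) : bool :=
  match a, l with
  | inl x, inl y => x == y
  | inr V, inr p => beval V p
  | _, _ => false
  end.

Definition is_atom (a : Sigma + {set Omega}) := if a is inr _ then true else false.

Lemma atomic_letter_le a l : atomic_below a l -> atomic_letter a <~ Letter l.
Proof.
case: a l => [x|V] [y|p] //= => [/eqP->|Vp]; first exact: KA_le_refl.
by apply: test_le; have := atom_and V p; rewrite Vp.
Qed.

Lemma letter_le_atomic l z :
  (forall a, atomic_below a l -> atomic_letter a <~ z) -> Letter l <~ z.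
Proof.
case: l => [x|p] le_z; first exact: (le_z (inl x) (eqxx x)).
apply: test_le_atoms (enum_uniq Omega) _ => V.
apply: KA_le_trans (test_BA_le (atom_and V p)) _.
case: ifP => [Vp|_]; first exact: (le_z (inr V) Vp).
exact: KA_le_trans (KA_hyp (kao_bot_le _ _)) (KA_zero_le _ _).
Qed.

Lemma atomic_letter_contracting a :
  is_atom a -> atomic_letter a <~ atomic_letter a * atomic_letter a.
Proof. by case: a => // V _; apply: test_le_dot. Qed.

(** Induction on the closure. For each hypothesis except [kao_and], a refinement of a word on the
    left is already a refinement of a word on the right, or the left has no refinement at all. *)
Lemma accepting_Hclosure (N : automaton X (Sigma + {set Omega})) (L : language X) :
  (forall v, refinements atomic_below L v ->
     accepting (relation_of_word is_atom N v)) ->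
  forall v, refinements atomic_below (Hclosure H L) v ->
     accepting (relation_of_word is_atom N v).
Proof.
move=> accL v [w Hw]; elim: Hw v => {w} [w Lw v vw|e f u w x Hef _ IH ex v].
  by apply: accL; exists w.
case/List.Forall2_app_inv_r=> v1 [v' [vu [/List.Forall2_app_inv_r]]].
case=> v2 [v3 [vx [vw ->]]] -> {v v'}.
have {}IH v : refinements atomic_below (lang f) v ->
    accepting (relation_of_word is_atom N (v1 ++ v ++ v3)).
  case=> y fy vy; apply: IH fy _ _.
  by apply: List.Forall2_app vu (List.Forall2_app vy vw).
have letterP a l : atomic_below a l ->
  refinements atomic_below (lang (Letter l)) [:: a].
  by move=> al; exists [:: l] => //; constructor.
have single l : lang (Letter l) x -> exists2 a, v2 = [:: a] & atomic_below a l.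
  move=> lx; move: vx; rewrite lx => vx; inversion vx as [|a l' v' w' al vw']; subst.
  by inversion vw'; exists a.
case: Hef IH ex => {e f} [_ _ [p q pq]|p q|p q|p q||] IH /=.
- case/single=> a -> ap; apply: (IH [:: a]); apply: letterP.
  case: a ap => //= V.
  by rewrite (BA_derives_sound pq).
(* An atom below [BAnd p q] is below both factors, so its square refines the product; saturation
   contracts the square to the atom. *)
- case/single=> -[//|V] -> /= /andP[Vp Vq].
  apply: accepting_contraction => //; apply: (IH [:: inr V; inr V]).
  exists [:: inr p; inr q]; last by do !constructor.
  by exists [:: inr p], [:: inr q].
- case/single=> -[//|V] -> /= /orP[Vp|Vq]; apply: (IH [:: inr V]).
    by exists [:: inr p]; [left | do !constructor].
  by exists [:: inr q]; [right | do !constructor].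
- case=> /single[] -[//|V] -> /= Vp; apply: (IH [:: inr V]); apply: letterP;
  by rewrite /= Vp ?orbT.
(* No valuation satisfies [BBot], so there is nothing to refine it. *)
- by case/single=> -[].
- by [].
Qed.

End Tests.

(** * Completeness for inequations and for equations *)

Lemma KA_le_of_Hclosure (Sigma Omega : finType) (e f : kao_regexp Sigma Omega) :
  (forall w, lang e w -> Hclosure (@H_kao Sigma Omega) (lang f) w) ->
  KA_le (@H_kao Sigma Omega) e f.
Proof.
move=> sub_ef.
have [N L accN] := Thompson (@atomic_letter_le Sigma Omega) f.
have acc v : refinements (@atomic_below Sigma Omega) (lang e) v ->
    accepting (relation_of_word (@is_atom Sigma Omega) N v).
  case=> w /sub_ef ew vw.
  apply: (accepting_Hclosure (L := lang f)); last by exists w.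
  by move=> v' /accN; apply: accepts_accepting.
apply: KA_le_trans
  (le_sum_preimages (@rel_compA _) (@rel_comp1 _) (@rel_compr1 _)
     (saturated_step (@is_atom Sigma Omega) N) e
     (@letter_le_atomic Sigma Omega)) _.
apply: KA_sum_le => m /asboolP[v /acc v_acc <-].
exact: (preimage_regexp_le (@atomic_letter_contracting Sigma Omega) L v_acc).
Qed.

Theorem theorem6p4 (Sigma Omega : finType) (e f : kao_regexp Sigma Omega) :
  (forall w : seq (Sigma + bexp Omega),
     Hclosure (@H_kao Sigma Omega) (lang e) w <->
     Hclosure (@H_kao Sigma Omega) (lang f) w) ->
  KA_derives (@H_kao Sigma Omega) e f.
Proof.
move=> ef; apply: KA_le_anti; apply: KA_le_of_Hclosure => w w_in; apply/ef;
  exact: closure_base.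
Qed.
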